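(* Let $t,n\ge1$, $p\ge t+2$, let $g\in\{1,\ldots,n\}$, and let $A$ be a cluster of grading $(g,\ldots,g)\in\{1,\ldots,n\}^t$. If $\alpha,\beta$ are configurations belonging to $A$, then every valid configuration sequence from $\alpha$ to $\beta$ of minimal transfer length (among all valid configuration sequences starting at $\alpha$ and ending at $\beta$) consists entirely of configurations belonging to $A$.
   Context: Setting (parallel Tower of Hanoi): there are $t$ towers (colors) of $n$ disks each and $p\ge t+2$ posts forming a set $\mathfrak{P}$. Disk $d_{u,j}$ ($u\in\{1,\ldots,t\}$, $j\in\{1,\ldots,n\}$) is the $j$-th largest disk of color $u$; smaller index means larger disk, and disks of the same index have equal size. A configuration is a $t\times n$ matrix $(a_{u,j})$ with entries in $\mathfrak{P}$, where $a_{u,j}$ is the post occupied by $d_{u,j}$, such that for each $j$ the entries $a_{1,j},\ldots,a_{t,j}$ are pairwise distinct (no disk on a smaller or equal-sized disk; disks on a post are stacked by size). Configurations $\alpha=(a_{u,j})$ and $\beta=(b_{u,j})$ are EREW-adjacent if (i) $a_{u,j}\ne b_{u,j}$ for at least one $(u,j)$, and (ii) whenever $a_{u,j}\ne b_{u,j}$, for all $v\in\{1,\ldots,t\}$ and all $y>j$ we have $a_{v,y}\ne a_{u,j}$ and $b_{v,y}\ne b_{u,j}$. A valid configuration sequence is a finite sequence $(\alpha_1,\ldots,\alpha_w)$ in which each consecutive pair is either equal or EREW-adjacent. For a pair of configurations let $e(\alpha,\beta)$ be the number of disks $d_{u,j}$ with $a_{u,j}\ne b_{u,j}$ (so $e(\alpha,\alpha)=0$);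 the transfer length of $(\alpha_1,\ldots,\alpha_w)$ is $\sum_{1\le v<w} e(\alpha_v,\alpha_{v+1})$. For $\mathbf{g}=(g_1,\ldots,g_t)\in\{0,\ldots,n\}^t$, a cluster of grading $\mathbf{g}$ is the set of all configurations in which, for each $u$, the disks $d_{u,1},\ldots,d_{u,g_u}$ occupy prescribed fixed posts. *)

(* Defs.v *)
From HB Require Import structures.
From mathcomp Require Import all_boot matrix.

Set Implicit Arguments.
Unset Strict Implicit.
Unset Printing Implicit Defensive.

(* Indices are shifted by one: rows u : 'I_t are the colours,
   columns j : 'I_n the disk sizes, column 0 holding the largest disks. *)

Definition columns_distinct (t n : nat) (P : finType) (a : 'M[P]_(t, n)) : bool :=
  [forall j : 'I_n, injectiveb (fun u : 'I_t => a u j)].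

Record config (t n : nat) (P : finType) := Config {
  config_mx :> 'M[P]_(t, n);
  config_mxP : columns_distinct config_mx
}.

HB.instance Definition _ (t n : nat) (P : finType) :=
  [isSub for @config_mx t n P].
HB.instance Definition _ (t n : nat) (P : finType) :=
  [Finite of config t n P by <:].

Section Hanoi.

Variables (t n : nat) (P : finType).
Implicit Types (a b : config t n P) (s : seq (config t n P)).

Definition erew_adjacent a b : bool :=
  [exists u : 'I_t, exists j : 'I_n, a u j != b u j] &&
  [forall u : 'I_t, forall j : 'I_n, (a u j != b u j) ==>
    [forall v : 'I_t, forall y : 'I_n, (j < y) ==>
      (a v y != a u j) && (b v y != b u j)]].

Definition erew_step a b : bool := (a == b) || erew_adjacent a b.

Definition moved_disks a b : nat :=
  #|[set d : 'I_t * 'I_n | a d.1 d.2 != b d.1 d.2]|.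

Definition valid_sequence s : bool := sorted erew_step s.

(* The empty sequence has no endpoints, so it satisfies this for no a, b. *)
Definition from_to a b s : bool :=
  if s is x :: s' then (x == a) && (last x s' == b) else false.

(* pairmap e x [:: y1; y2; ...] = [:: e x y1; e y1 y2; ...] *)
Definition transfer_length s : nat :=
  if s is x :: s' then sumn (pairmap moved_disks x s') else 0.

Definition minimal_sequence a b s : Prop :=
  [/\ valid_sequence s, from_to a b s &
      forall s', valid_sequence s' -> from_to a b s' ->
        transfer_length s <= transfer_length s'].

(* c prescribes the posts; its values at columns j >= g u are irrelevant. *)
Definition is_cluster (g : 'I_t -> 'I_n.+1) (A : {set config t n P}) : Prop :=
  exists c : 'I_t -> 'I_n -> P,
    A = [set a : config t n P |
          [forall u : 'I_t, forall j : 'I_n, (j < g u) ==> (a u j == c u j)]].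

End Hanoi.

(* Main.v *)
(* A disk never constrains the moves of strictly smaller disks.  Hence freezing
   the g largest disks of every colour at their initial posts keeps a sequence
   valid.  It fixes both endpoints, since these agree on the frozen disks, and it
   strictly decreases the transfer length as soon as a frozen disk moved. *)
Require Import Defs.
From mathcomp Require Import all_boot matrix.

Set Implicit Arguments.
Unset Strict Implicit.
Unset Printing Implicit Defensive.

Section Freeze.

Variables (t n : nat) (P : finType) (g : nat).
Implicit Types (a b x y : config t n P) (s : seq (config t n P)).

Definition agree a b : bool :=
  [forall u : 'I_t, forall j : 'I_n, (j < g) ==> (a u j == b u j)].

Lemma agreeP a b :
  reflect (forall (u : 'I_t) (j : 'I_n), j < g -> a u j = b u j) (agree a b).
Proof.
apply: (iffP forallP) => [h u j jg | h u].
  by move/forallP/(_ j)/implyP/(_ jg)/eqP: (h u).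
by apply/forallP => j; apply/implyP => jg; apply/eqP/h.
Qed.

Definition freeze_mx a x : 'M[P]_(t, n) :=
  \matrix_(u, j) if j < g then a u j else x u j.

(** The cutoff [g] is common to all colours, so each column is copied whole from [a] or whole from
    [x] and inherits its injectivity. *)
Lemma freeze_columns_distinct a x : columns_distinct (freeze_mx a x).
Proof.
apply/forallP => j; apply/injectiveP => u v; rewrite !mxE.
by case: ifP => _; [move: (config_mxP a) | move: (config_mxP x)]
  => /forallP/(_ j)/injectiveP; apply.
Qed.

Definition freeze a x : config t n P := Config (freeze_columns_distinct a x).

Lemma freezeE a x (u : 'I_t) (j : 'I_n) :
  freeze a x u j = if j < g then a u j else x u j.
Proof. by rewrite mxE. Qed.

Lemma freeze_id a x : agree a x -> freeze a x = x.
Proof.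
move/agreeP=> ax; apply/val_inj/matrixP => u j.
by rewrite freezeE; case: ifP => // /ax.
Qed.

Lemma freeze_neq a x y (u : 'I_t) (j : 'I_n) :
  (freeze a x u j != freeze a y u j) = (g <= j) && (x u j != y u j).
Proof. by rewrite !freezeE; case: ltnP; rewrite ?eqxx. Qed.

(** Freezing may cancel every move of the step, which then becomes an equality. A disk that still
    moves lies in a column [j >= g], and its constraints involve only that column and later ones,
    where freezing changes nothing. *)
Lemma freeze_step a x y : erew_step x y -> erew_step (freeze a x) (freeze a y).
Proof.
rewrite /erew_step => /predU1P[-> | /andP[_ /forallP adj]]; first by rewrite eqxx.
case: eqP => //= neq; apply/andP; split.
  apply: contra_notT neq => /existsPn h; apply/val_inj/matrixP => u j.
  by apply/eqP; have /existsPn/(_ j) := h u; rewrite negbK.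
apply/forallP => u; apply/forallP => j; apply/implyP.
rewrite freeze_neq => /andP[gj xy].
apply/forallP => v; apply/forallP => k; apply/implyP => jk.
move/forallP/(_ j)/implyP/(_ xy)/forallP/(_ v)/forallP/(_ k)/implyP/(_ jk): (adj u).
by rewrite !freezeE !ltnNge gj (leq_trans gj (ltnW jk)).
Qed.

Lemma freeze_moved_subset a x y :
  [set d : 'I_t * 'I_n | freeze a x d.1 d.2 != freeze a y d.1 d.2] \subset
  [set d : 'I_t * 'I_n | x d.1 d.2 != y d.1 d.2].
Proof. by apply/subsetP => d; rewrite !inE freeze_neq => /andP[]. Qed.

Lemma freeze_moved_le a x y :
  moved_disks (freeze a x) (freeze a y) <= moved_disks x y.
Proof. exact/subset_leq_card/freeze_moved_subset. Qed.

(** The disks moved after freezing are among those moved before. If their number does not drop, the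
    two sets coincide, and the former contains no disk of a column below [g]. *)
Lemma freeze_moved_agree a x y :
  moved_disks x y <= moved_disks (freeze a x) (freeze a y) -> agree x y.
Proof.
move=> le; apply/agreeP => u j jg.
have /eqP/setP/(_ (u, j)) :
    [set d : 'I_t * 'I_n | freeze a x d.1 d.2 != freeze a y d.1 d.2] ==
    [set d : 'I_t * 'I_n | x d.1 d.2 != y d.1 d.2].
  by rewrite eqEcard freeze_moved_subset.
by rewrite !inE freeze_neq leqNgt jg => /esym/negbFE/eqP.
Qed.

Lemma freeze_length_le a x s :
  transfer_length (map (freeze a) (x :: s)) <= transfer_length (x :: s).
Proof.
by elim: s x => //= y s IH x; apply: leq_add (freeze_moved_le _ _ _) (IH y).
Qed.

(** No term of the sum grows under freezing, so a total that does not drop forces every term not to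
    drop. Consecutive configurations then agree, and agreement with the head follows by
    transitivity. *)
Lemma freeze_length_agree a x s :
  transfer_length (x :: s) <= transfer_length (map (freeze a) (x :: s)) ->
  all (agree x) s.
Proof.
elim: s x => //= y s IH x le.
have le_head := freeze_moved_le a x y; have le_tail := freeze_length_le a y s.
have /agreeP xy : agree x y.
  apply: (freeze_moved_agree (a := a)); rewrite -(leq_add2r (transfer_length (y :: s))).
  by apply: leq_trans le _; rewrite leq_add2l.
apply/andP; split; first exact/agreeP.
have /IH : transfer_length (y :: s) <= transfer_length (map (freeze a) (y :: s)).
  rewrite -(leq_add2l (moved_disks x y)).
  by apply: leq_trans le _; rewrite leq_add2r.
apply: sub_all => z /agreeP yz; apply/agreeP => u j jg.
by rewrite xy ?yz.
Qed.

End Freeze.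

Theorem theorem1 (t n : nat) (P : finType) (g : 'I_n.+1)
    (A : {set config t n P}) (alpha beta : config t n P)
    (s : seq (config t n P)) :
  1 <= t -> 1 <= n -> t + 2 <= #|P| -> 1 <= g ->
  is_cluster (fun _ : 'I_t => g) A ->
  alpha \in A -> beta \in A ->
  minimal_sequence alpha beta s ->
  forall gamma : config t n P, gamma \in s -> gamma \in A.
Proof.
move=> _ _ _ _ [c defA] alphaA betaA.
have inA (x : config t n P) :
    reflect (forall (u : 'I_t) (j : 'I_n), j < g -> x u j = c u j) (x \in A).
  rewrite defA inE; apply: (iffP forallP) => [h u j jg | h u].
    by move/forallP/(_ j)/implyP/(_ jg)/eqP: (h u).
  by apply/forallP => j; apply/implyP => jg; apply/eqP/h.
(* As [alpha] lies in [A], the posts prescribed by [c] can be read off [alpha]. *)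
have agreeA x : agree g alpha x = (x \in A).
  apply/agreeP/inA => h u j jg; first by rewrite -(inA _ alphaA) ?h.
  by rewrite (inA _ alphaA) ?h.
case: s => [|x s] [] // valid /andP[/eqP x_alpha /eqP last_beta] minimal.
subst x; have /minimal : valid_sequence (map (freeze g alpha) (alpha :: s)).
  by apply: homo_sorted valid; apply: freeze_step.
rewrite /from_to map_cons last_map last_beta !freeze_id ?agreeA // !eqxx.
rewrite -{2}[alpha](@freeze_id _ _ _ g alpha alpha) ?agreeA //.
move=> /(_ isT)/freeze_length_agree/allP agree_s gamma.
by rewrite inE => /predU1P[-> // | /agree_s]; rewrite agreeA.
Qed.
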